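(* The map $\perp:\mathrm{Gr}(n)\to \mathrm{Gr}(n)$, $\perp(V)=V^\perp$, is a homeomorphism $\mathrm{Gr}^-(n)\cong \mathrm{Gr}^+(n)$ and a self-homeomorphism of $\mathrm{Gr}(n)$ with the topology $\tau$, mapping $\mathrm{Gr}_p(n)$ homeomorphically onto $\mathrm{Gr}_{n-p}(n)$.
   Context: $\mathbb{F}=\mathbb{R}$ or $\mathbb{C}$, $\mathbb{F}^n$ has its canonical inner product (Hermitian if $\mathbb{F}=\mathbb{C}$), $\mathrm{Gr}(n)$ is the set of all subspaces of $\mathbb{F}^n$, $\mathrm{Gr}_p(n)$ those of dimension $p$; $V_{(p)}$ indicates $\dim V=p$. Principal angles of $V_{(p)},W_{(q)}$ with $m=\min\{p,q\}\neq0$: $0\leq\theta_1\leq\cdots\leq\theta_m\leq\frac\pi2$, $\theta_i=\cos^{-1}\sigma_i$, where $\sigma_1\geq\cdots\geq\sigma_m$ are the singular values of the orthogonal projection $V\to W$. Let $d$ be any one of the following nine asymmetric metrics (they all give the same topologies below). For $V_{(p)},W_{(q)}$, $d(V,W)=0$ if $p=0$, and $d(V,W)=\Delta_{p,d}$ if $p>q$. If $0<p\leq q$: $d_{\mathrm{g}}=\sqrt{\sum_{i=1}^p\theta_i^2}$, $d_{\mathrm{cF}}=2\sqrt{\sum_{i=1}^p\sin^2\frac{\theta_i}{2}}$, $d_{\mathrm{pF}}=\sqrt{\sum_{i=1}^p\sin^2\theta_i}$, $d_{\mathrm{FS}}=\cos^{-1}(\prod_{i=1}^p\cos\theta_i)$,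 $d_{\mathrm{c\wedge}}=\sqrt{2-2\prod_{i=1}^p\cos\theta_i}$, $d_{\mathrm{BC}}=\sqrt{1-\prod_{i=1}^p\cos^2\theta_i}$, $d_{\mathrm{A}}=\theta_p$, $d_{\mathrm{c2}}=2\sin\frac{\theta_p}{2}$, $d_{\mathrm{p2}}=\sin\theta_p$. For $p>0$ the constants $\Delta_{p,d}$ are, respectively, $\frac\pi2\sqrt p$, $\sqrt{2p}$, $\sqrt p$, $\frac\pi2$, $\sqrt2$, $1$, $\frac\pi2$, $\sqrt2$, $1$. Topologies: $\tau^-$ is generated by the balls $\{U:d(U,V)<r\}$, $\tau^+$ by the balls $\{U:d(V,U)<r\}$, and $\tau$ by the balls $\{U:\max\{d(U,V),d(V,U)\}<r\}$. $\mathrm{Gr}^\pm(n)$ is $\mathrm{Gr}(n)$ with $\tau^\pm$. Each $\mathrm{Gr}_p(n)$ has its usual Grassmannian topology, which is its subspace topology for $\tau^-$, $\tau^+$ or $\tau$. *)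

(* Defs.v *)
From HB Require Import structures.
From mathcomp Require Import all_boot all_order all_algebra.
From mathcomp Require Import complex sesquilinear.
From mathcomp Require Import all_classical all_reals all_analysis.

Set Implicit Arguments.
Unset Strict Implicit.
Unset Printing Implicit Defensive.

Import Order.TTheory GRing.Theory Num.Theory numFieldNormedType.Exports.

Local Open Scope classical_set_scope.
Local Open Scope ring_scope.

Variant scalars := RealScalars | ComplexScalars.

Definition scal (R : realType) (k : scalars) : numFieldType :=
  match k with RealScalars => R | ComplexScalars => R[i] end.

Definition scal_conj (R : realType) (k : scalars) :
    {rmorphism scal R k -> scal R k} :=
  match k return {rmorphism scal R k -> scal R k} with
  | RealScalars => idfun
  | ComplexScalars => @conjc R
  end.

Definition scal_of_real (R : realType) (k : scalars) : R -> scal R k :=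
  match k return R -> scal R k with
  | RealScalars => id
  | ComplexScalars => real_complex R
  end.

Lemma scal_conjK (R : realType) (k : scalars) : involutive (@scal_conj R k).
Proof. by case: k => //; exact: conjcK. Qed.

Definition inner (R : realType) (k : scalars) (n : nat)
    (u v : 'rV[scal R k]_n) : scal R k :=
  \sum_(j < n) u 0 j * scal_conj R k (v 0 j).

Section InnerProduct.
Variables (R : realType) (k : scalars) (n : nat).
Local Notation inner := (@inner R k n).

Fact inner_bilinear : bilinear_for
  (GRing.Scale.Law.clone _ _ *%R _)
  (GRing.Scale.Law.clone _ _ (scal_conj R k \; *%R) _) inner.
Proof.
split=> [w|w] a u v; rewrite /inner /= mulr_sumr -big_split /=;
  apply: eq_bigr => j _; rewrite !mxE.
  by rewrite mulrDl mulrA.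
by rewrite rmorphD rmorphM mulrDr mulrCA.
Qed.

HB.instance Definition _ := bilinear_isBilinear.Build (scal R k)
  'rV[scal R k]_n 'rV[scal R k]_n (scal R k) *%R (scal_conj R k \; *%R)
  inner inner_bilinear.

Fact inner_hermitian u v :
  inner u v = (-1) ^+ false * scal_conj R k (inner v u).
Proof.
rewrite /inner mul1r rmorph_sum; apply: eq_bigr => j _.
by rewrite rmorphM scal_conjK mulrC.
Qed.

HB.instance Definition _ := isHermitianSesquilinear.Build (scal R k)
  'rV[scal R k]_n false (scal_conj R k) inner inner_hermitian.

End InnerProduct.

Definition Gr (R : realType) (k : scalars) (n : nat) : Type :=
  {vspace 'rV[scal R k]_n}.

Section Grassmannian.
Variables (R : realType) (k : scalars) (n : nat).
Local Notation F := (scal R k).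
Local Notation Gr := (Gr R k n).

HB.instance Definition _ := Choice.copy Gr {vspace 'rV[F]_n}.
HB.instance Definition _ := isPointed.Build Gr (0%VS : {vspace 'rV[F]_n}).

Implicit Types V W : {vspace 'rV[F]_n}.

Definition perp V : {vspace 'rV[F]_n} := orthov (@inner R k n) V.

Definition orthoproj W : 'End('rV[F]_n) := daddv_pi W (perp W).

Definition orthonormal_basis V (e : seq 'rV[F]_n) : Prop :=
  basis_of V e /\ orthonormal (@inner R k n) e.

(* Singular value decomposition of the linear map V -> W induced by T: its
   matrix in suitable orthonormal bases of V and W is rectangular diagonal,
   with diagonal s. *)
Definition is_singular_values V W (T : 'End('rV[F]_n)) (s : seq R) : Prop :=
  [/\ size s = minn (\dim V) (\dim W),
      sorted >=%R s,
      all (fun x => 0 <= x) s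
    & exists e f : seq 'rV[F]_n,
      [/\ orthonormal_basis V e,
          orthonormal_basis W f
        & forall i j, (i < \dim V)%N -> (j < \dim W)%N ->
            inner (T e`_i) f`_j = scal_of_real k (s`_i) *+ (i == j)]].

Definition singular_values V W (T : 'End('rV[F]_n)) : seq R :=
  xget [::] [set s | is_singular_values V W T s].

Definition principal_angles V W : seq R :=
  [seq acos x | x <- singular_values V W (orthoproj W)].

End Grassmannian.

Variant metric :=
  | Geodesic | ChordalFrobenius | ProjectionFrobenius
  | FubiniStudy | ChordalWedge | BinetCauchy
  | Asimov | Chordal2 | Projection2.

(* The distance from a subspace of dimension p > 0 to one of smaller
   dimension. *)
Definition Delta (R : realType) (d : metric) (p : nat) : R :=
  match d with
  | Geodesic => pi / 2 * Num.sqrt p%:R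
  | ChordalFrobenius => Num.sqrt (2 * p%:R)
  | ProjectionFrobenius => Num.sqrt p%:R
  | FubiniStudy => pi / 2
  | ChordalWedge => Num.sqrt 2
  | BinetCauchy => 1
  | Asimov => pi / 2
  | Chordal2 => Num.sqrt 2
  | Projection2 => 1
  end.

(* theta`_i is the angle of index i + 1, and p > 0. *)
Definition dist_of_angles (R : realType) (d : metric) (p : nat)
    (theta : seq R) : R :=
  match d with
  | Geodesic => Num.sqrt (\sum_(i < p) theta`_i ^+ 2)
  | ChordalFrobenius => 2 * Num.sqrt (\sum_(i < p) sin (theta`_i / 2) ^+ 2)
  | ProjectionFrobenius => Num.sqrt (\sum_(i < p) sin theta`_i ^+ 2)
  | FubiniStudy => acos (\prod_(i < p) cos theta`_i)
  | ChordalWedge => Num.sqrt (2 - 2 * \prod_(i < p) cos theta`_i)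
  | BinetCauchy => Num.sqrt (1 - \prod_(i < p) cos theta`_i ^+ 2)
  | Asimov => theta`_p.-1
  | Chordal2 => 2 * sin (theta`_p.-1 / 2)
  | Projection2 => sin theta`_p.-1
  end.

Definition dist (R : realType) (k : scalars) (n : nat) (d : metric)
    (V W : Gr R k n) : R :=
  let p := \dim V in
  if p == 0%N then 0
  else if (\dim W < p)%N then Delta R d p
  else dist_of_angles d p (principal_angles V W).

(* Copies of the set of all subspaces carrying the topologies generated by the
   balls {U | dist U V < r}, {U | dist V U < r} and
   {U | max (dist U V) (dist V U) < r} respectively. *)
Definition Gr_minus (R : realType) (k : scalars) (n : nat) (d : metric) : Type :=
  Gr R k n.
Definition Gr_plus (R : realType) (k : scalars) (n : nat) (d : metric) : Type :=
  Gr R k n.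
Definition Gr_sym (R : realType) (k : scalars) (n : nat) (d : metric) : Type :=
  Gr R k n.

Section BallTopologies.
Variables (R : realType) (k : scalars) (n : nat) (d : metric).
Local Notation Gr := (Gr R k n).

HB.instance Definition _ := Choice.copy (Gr_minus R k n d) Gr.
HB.instance Definition _ := Choice.copy (Gr_plus R k n d) Gr.
HB.instance Definition _ := Choice.copy (Gr_sym R k n d) Gr.

HB.instance Definition _ := isSubBaseTopological.Build (Gr_minus R k n d)
  [set Vr : Gr * R | 0 < Vr.2]
  (fun Vr => [set U | dist d U Vr.1 < Vr.2]).

HB.instance Definition _ := isSubBaseTopological.Build (Gr_plus R k n d)
  [set Vr : Gr * R | 0 < Vr.2]
  (fun Vr => [set U | dist d Vr.1 U < Vr.2]).

HB.instance Definition _ := isSubBaseTopological.Build (Gr_sym R k n d)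
  [set Vr : Gr * R | 0 < Vr.2]
  (fun Vr => [set U | Num.max (dist d U Vr.1) (dist d Vr.1 U) < Vr.2]).

End BallTopologies.

Definition Gr_dim (R : realType) (k : scalars) (n p : nat) : Type :=
  {V : {vspace 'rV[scal R k]_n} | \dim V == p}.

Section UsualTopology.
Variables (R : realType) (k : scalars) (n p : nat).
Local Notation F := (scal R k).
Local Notation Gr_dim := (Gr_dim R k n p).

Definition frames : set 'M[F]_(p, n) := [set A | row_free A].

Definition row_vspace (A : 'M[F]_(p, n)) : {vspace 'rV[F]_n} :=
  <<[tuple row i A | i < p]>>%VS.

Lemma dim_row_vspace (A : 'M[F]_(p, n)) :
  row_free A -> \dim (row_vspace A) == p.
Proof.
move=> Afree; suff: free [tuple row i A | i < p].
  by rewrite /free size_tuple.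
apply/freeP => c cA0 i.
have : \row_j c j *m A = 0 *m A.
  rewrite mul0mx -[RHS]cA0 mulmx_sum_row; apply: eq_bigr => j _.
  by rewrite mxE -tnth_nth tnth_mktuple.
by move=> /(row_free_inj Afree)/rowP/(_ i); rewrite !mxE.
Qed.

Definition frame_span (A : frames) : Gr_dim :=
  exist _ (row_vspace (set_val A)) (dim_row_vspace (set_valP A)).

(* The usual topology: the quotient topology of the space of p-frames (as a
   subspace of the p x n matrices) by the map sending a frame to its span. *)
Definition usual_open (U : set Gr_dim) : Prop := open (frame_span @^-1` U).

Fact usual_openT : usual_open setT.
Proof. exact: openT. Qed.

Fact usual_openI : setI_closed usual_open.
Proof. by move=> U V; exact: openI. Qed.

Fact usual_open_bigU (I : Type) (U : I -> set Gr_dim) :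
  (forall i, usual_open (U i)) -> usual_open (\bigcup_i U i).
Proof. by move=> oU; apply: bigcup_open => i _; exact: oU. Qed.

HB.instance Definition _ := Choice.on Gr_dim.
HB.instance Definition _ := isOpenTopological.Build Gr_dim
  usual_openT usual_openI usual_open_bigU.

End UsualTopology.

Definition homeomorphism (X Y : topologicalType) (f : X -> Y) : Prop :=
  continuous f /\
  exists g : Y -> X, [/\ cancel f g, cancel g f & continuous g].

(* f maps A homeomorphically onto B, for the subspace topologies. *)
Definition homeomorphic_onto (X Y : topologicalType) (f : X -> Y)
    (A : set X) (B : set Y) : Prop :=
  exists g : A -> B,
    (forall x, set_val (g x) = f (set_val x)) /\ homeomorphism g.

(* Main.v *)
From HB Require Import structures.
Require Import Defs.
From mathcomp Require Import all_boot all_order all_algebra.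
From mathcomp Require Import complex sesquilinear spectral finmap.
From mathcomp Require Import zify lra ring.
From mathcomp Require Import all_classical all_reals all_analysis.

Set Implicit Arguments.
Unset Strict Implicit.
Unset Printing Implicit Defensive.

Import Order.TTheory GRing.Theory Num.Theory numFieldNormedType.Exports.

Local Open Scope classical_set_scope.
Local Open Scope ring_scope.

(** Write [V^perp] for the orthogonal complement of [V], [P_W] for the orthogonal
projection onto [W], and [p], [q] for the dimensions of [V], [W].

Isometry. Suppose that [p <= q]. Then the pairs [(V, W)] and [(W^perp, V^perp)]
have the same nonzero principal angles ([perp_principal_angles]). Indeed, let [e]
be the orthonormal basis of [V] in a singular value decomposition of the
projection of [V] to [W], let [g] be that of [W^perp] for the pair
[(W^perp, V^perp)], and let [K] be the matrix of the inner products
[<e_i, g_j>]. By Parseval's identity, [K] times its adjoint is the Gram matrix of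
[e] minus that of the projections of [e] to [W], which is diagonal with entries
[1 - cos^2 theta_i] ([gram_perp]); for the same reason, the adjoint of [K] times
[K] is diagonal with the squared sines of the angles of [(W^perp, V^perp)]. By
Sylvester's identity ([char_poly_mulC]) both matrices have the same nonzero
eigenvalues. A zero angle contributes to none of the nine distances, whence
[d(W^perp, V^perp) = d(V, W)] ([dist_perp]).

Topologies. If [p > q] then [d(V, W)] is the constant [Delta_p], while
[d(W^perp, V^perp)] is [Delta_(n - q)]; in general these differ, so that the
complements of the subspaces in a ball need not form a ball. Two facts make up
for this: [Delta] is nondecreasing and bounds the distance ([dist_le_Delta]), and
dimension is semicontinuous: dimension at most [j] is an open condition for
[tau^-], dimension at least [j] for [tau^+], and dimension [j] for [tau]. The
preimage of a ball under [perp] is the union of the part of a ball where the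
dimension lies in a certain range, which is handled by the isometry, and of a set
that is defined by the dimension alone. Both are open.

Grassmannians. For the usual topology, a frame of [V^perp] must depend
continuously on a frame [A] of [V], locally. Complete the adjoint of [A] by fixed
columns to a square matrix, invertible at and hence near a given frame; the last
rows of the adjugate of this matrix span [V^perp], and they are polynomials in
the entries of [A] and their conjugates ([perp_frame]). *)

(** * Real and complex scalars *)

Section Scalars.
Variables (R : realType) (k : scalars).
Local Notation F := (scal R k).
Local Notation conj := (@scal_conj R k).
Local Notation "x %:F"  := (scal_of_real k x).

Fact scal_of_real_is_zmod_morphism : zmod_morphism (@scal_of_real R k).
Proof. by case: k => // x y; rewrite /= rmorphB. Qed.

Fact scal_of_real_is_monoid_morphism : monoid_morphism (@scal_of_real R k).
Proof. by case: k; split=> // x y; rewrite /= rmorphM. Qed.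

HB.instance Definition _ := GRing.isZmodMorphism.Build R F (@scal_of_real R k)
  scal_of_real_is_zmod_morphism.
HB.instance Definition _ := GRing.isMonoidMorphism.Build R F (@scal_of_real R k)
  scal_of_real_is_monoid_morphism.

Lemma scal_conj_real (x : R) : conj x%:F = x%:F.
Proof. by case: k => //=; exact: conjc_real. Qed.

Definition sqabs : F -> R :=
  match k return scal R k -> R with
  | RealScalars => fun x => x ^+ 2
  | ComplexScalars => fun x => complex.Re x ^+ 2 + complex.Im x ^+ 2
  end.

Lemma sqabsE (x : F) : x * conj x = (sqabs x)%:F.
Proof.
rewrite /sqabs; case: k x => x /=; first by rewrite expr2.
by rewrite -sqr_normc add_Re2_Im2.
Qed.

Lemma sqabs_ge0 (x : F) : 0 <= sqabs x.
Proof. by rewrite /sqabs; case: k x => x; rewrite ?addr_ge0 ?sqr_ge0. Qed.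

Lemma norm_scal_conj (x : F) : `|conj x| = `|x|.
Proof. by case: k x => //= x; exact: normcJ. Qed.

Definition to_complex : {rmorphism F -> R[i]} :=
  match k return {rmorphism scal R k -> R[i]} with
  | RealScalars => real_complex R
  | ComplexScalars => idfun
  end.

Lemma to_complex_conj (x : F) : to_complex (conj x) = (to_complex x)^*%C.
Proof. by rewrite /to_complex; case: k x => //= x; exact/esym/conjc_real. Qed.

Lemma to_complex_real (x : R) : to_complex x%:F = real_complex R x.
Proof. by rewrite /to_complex; case: k. Qed.

(** An eigenvalue exists in the complex numbers. Being the quotient of two real
    numbers, [v H v^*] by [v v^*] for an eigenvector [v], it is real, hence in
    the scalar field in both cases. *)
Lemma hermitian_eigenvalue (p : nat) (H : 'M[F]_p) : (0 < p)%N ->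
  (forall i j, H i j = conj (H j i)) -> exists a, eigenvalue H a.
Proof.
move=> p_gt0 Hherm; set HC := map_mx to_complex H.
have [a /eigenvalueP[v vH v0]] := eigenvalue_closed HC p_gt0.
pose w := v *m HC *m (map_mx conjc v)^T.
pose N := (v *m (map_mx conjc v)^T) 0 0.
have HCE i j : (HC i j)^*%C = HC j i.
  by rewrite !mxE -to_complex_conj -Hherm.
have wE : w 0 0 = a * N by rewrite /w /N vH -scalemxAl mxE.
have wr : (w 0 0)^*%C = w 0 0.
  rewrite /w !mxE rmorph_sum /=.
  under eq_bigr => j _ do rewrite rmorphM !mxE rmorph_sum mulr_suml /=.
  rewrite exchange_big; apply: eq_bigr => i _; rewrite !mxE mulr_suml.
  apply: eq_bigr => j _.
  by rewrite conjcK rmorphM /= HCE mulrC mulrA mulrAC.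
have NE : N = \sum_j `|v 0 j| ^+ 2.
  by rewrite /N mxE; apply: eq_bigr => j _; rewrite !mxE sqr_normc.
have N_neq0 : N != 0.
  apply: contra v0; rewrite NE psumr_eq0 => [|j _]; last exact: exprn_ge0.
  move=> /allP v0; apply/eqP/rowP => j.
  by have := v0 j (mem_index_enum _); rewrite mxE sqrf_eq0 normr_eq0 => /eqP.
have Nr : N^*%C = N.
  by rewrite NE rmorph_sum; apply: eq_bigr => j _;
    rewrite sqr_normc rmorphM /= conjcK mulrC.
have ar : a^*%C = a.
  by apply: (mulIf N_neq0); rewrite -wE -wr wE rmorphM /= Nr.
have aE : a = to_complex (complex.Re a)%:F.
  rewrite to_complex_real; case: a ar {vH wE} => x y /= [/eqP].
  by rewrite eq_sym -subr_eq0 opprK -mulr2n mulrn_eq0 /= => /eqP ->.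
exists (complex.Re a)%:F; rewrite -(eigenvalue_map to_complex) -aE.
by apply/eigenvalueP; exists v.
Qed.

End Scalars.

(** * Orthonormal bases and orthogonal complements *)

Section EuclideanSpace.
Variables (R : realType) (k : scalars) (n : nat).
Local Notation F := (scal R k).
Local Notation E := 'rV[F]_n.
Local Notation conj := (@scal_conj R k).
Local Notation inner := (@inner R k n).
Local Notation "x %:F" := (scal_of_real k x).
Local Notation "''[' u , v ]" := (inner u v).
Local Notation perp := (@perp R k n).
Local Notation orthoproj := (@orthoproj R k n).
Implicit Types (u v w : E) (V W : {vspace E}) (s t e f : seq E).

Definition sqnorm u : R := \sum_j sqabs (u 0 j).

Lemma innerZl a u v : '[a *: u, v] = a * '[u, v].
Proof. exact: linearZl_LR. Qed.

Lemma innerZr a u v : '[u, a *: v] = conj a * '[u, v].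
Proof. exact: linearZr_LR. Qed.

Lemma inner_suml I r (P : pred I) (G : I -> E) v :
  '[\sum_(i <- r | P i) G i, v] = \sum_(i <- r | P i) '[G i, v].
Proof. exact: linear_sumlz. Qed.

Lemma inner_sumr I r (P : pred I) (G : I -> E) v :
  '[v, \sum_(i <- r | P i) G i] = \sum_(i <- r | P i) '[v, G i].
Proof. exact: linear_sumr. Qed.

Lemma inner_self u : '[u, u] = (sqnorm u)%:F.
Proof. by rewrite rmorph_sum; apply: eq_bigr => j _; rewrite sqabsE. Qed.

Lemma sqnorm_ge0 u : 0 <= sqnorm u.
Proof. by apply: sumr_ge0 => j _; exact: sqabs_ge0. Qed.

Lemma sqnorm_eq0 u : (sqnorm u == 0) = (u == 0).
Proof.
apply/idP/eqP => [|->]; last first.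
  by rewrite -(fmorph_eq0 (@scal_of_real R k)) /= -inner_self linear0l.
rewrite psumr_eq0 => [/allP u0|j _]; last exact: sqabs_ge0.
apply/rowP => j; have /eqP := u0 j (mem_index_enum _).
move=> /(congr1 (scal_of_real k))/eqP; rewrite -sqabsE rmorph0 mulf_eq0.
by rewrite fmorph_eq0 orbb mxE => /eqP.
Qed.

Lemma innerC u v : '[u, v] = conj '[v, u].
Proof. by rewrite [LHS]hermC mul1r. Qed.

Lemma inner_eq0C u v : ('[u, v] == 0) = ('[v, u] == 0).
Proof. by rewrite innerC fmorph_eq0. Qed.

Lemma orthonormal_cons u s : orthonormal inner (u :: s) =
  [&& '[u, u] == 1, all (fun v => '[u, v] == 0) s & orthonormal inner s].
Proof. by rewrite /orthonormal /= !andbT andbACA -!andbA. Qed.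

Lemma orthonormal_rcons s u : orthonormal inner (rcons s u) =
  [&& '[u, u] == 1, all (fun v => '[u, v] == 0) s & orthonormal inner s].
Proof.
elim: s => [|v s IHs]; first by rewrite orthonormal_cons.
rewrite rcons_cons !orthonormal_cons IHs all_rcons /= inner_eq0C.
by do !case: (_ == _); rewrite /= ?andbF //; case: (all _ _); case: (all _ _).
Qed.

Lemma orthonormalP s :
  reflect (forall i j, (i < size s)%N -> (j < size s)%N ->
             '[s`_i, s`_j] = (i == j)%:R)
          (orthonormal inner s).
Proof.
elim: s => [|u s IHs]; first by apply: ReflectT.
rewrite orthonormal_cons; apply: (iffP and3P).
  move=> [/eqP u1 /(all_nthP 0)us /IHs sP] [|i] [|j] //= ilt jlt.
  - exact/eqP/us.
  - by apply/eqP; rewrite inner_eq0C; exact: us.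
  - exact: sP.
move=> sP; split; first by rewrite (sP 0%N 0%N).
  by apply/(all_nthP 0) => i ilt; rewrite (sP 0%N i.+1).
by apply/IHs => i j ilt jlt; exact: (sP i.+1 j.+1).
Qed.

Lemma orthonormal_nth s i j : orthonormal inner s ->
  (i < size s)%N -> (j < size s)%N -> '[s`_i, s`_j] = (i == j)%:R.
Proof. by move=> /orthonormalP; apply. Qed.

Lemma inner_orthonormal_sum s (c : 'I_(size s) -> F) (j : 'I_(size s)) :
  orthonormal inner s ->
  '[\sum_(i < size s) c i *: s`_i, s`_j] = c j.
Proof.
move=> son; rewrite inner_suml (bigD1 j) //= big1 => [|i ij].
  by rewrite innerZl (orthonormal_nth son) // eqxx mulr1 addr0.
by rewrite innerZl (orthonormal_nth son) // (negPf (ij : i != j :> nat)) mulr0.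
Qed.

Lemma orthonormal_free s : orthonormal inner s -> free s.
Proof.
move=> son; rewrite -[s]in_tupleE; apply/freeP => c c0 i.
have <- : '[0, s`_i] = c i by rewrite -{1}c0;
  exact: (inner_orthonormal_sum c i son).
exact: linear0l.
Qed.

Lemma orthonormal_expand s v : orthonormal inner s -> v \in << s >>%VS ->
  v = \sum_(i < size s) '[v, s`_i] *: s`_i.
Proof.
move=> son; rewrite -[s in << s >>%VS]in_tupleE => vs.
rewrite {1}(coord_span vs); apply: eq_bigr => i _; congr (_ *: _).
by rewrite {2}(coord_span vs); exact/esym/(inner_orthonormal_sum _ i son).
Qed.

Definition normalize v : E := ((Num.sqrt (sqnorm v))^-1)%:F *: v.

Lemma normalizeK v : v = (Num.sqrt (sqnorm v))%:F *: normalize v.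
Proof.
have [->|v0] := eqVneq v 0; first by rewrite /normalize !scaler0.
rewrite scalerA -rmorphM divff ?rmorph1 ?scale1r //.
by rewrite sqrtr_eq0 -ltNge lt_def sqnorm_ge0 sqnorm_eq0 v0.
Qed.

Lemma inner_normalize v : v != 0 -> '[normalize v, normalize v] = 1.
Proof.
move=> v0; rewrite innerZl innerZr inner_self scal_conj_real.
rewrite -!rmorphM mulrA -expr2 exprVn sqr_sqrtr ?sqnorm_ge0 //.
by rewrite mulVf ?rmorph1 // sqnorm_eq0.
Qed.

Lemma orthonormal_basis_size V e : orthonormal_basis V e -> size e = \dim V.
Proof. by move=> [/andP[/eqP <- /eqP]]. Qed.

Lemma orthonormal_basis_mem V e i : orthonormal_basis V e -> e`_i \in V.
Proof.
move=> [eV _]; have [ie|ie] := ltnP i (size e).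
  by apply: (basis_mem eV); rewrite mem_nth.
by rewrite nth_default ?mem0v.
Qed.

Lemma orthonormal_basis_expand V e v : orthonormal_basis V e -> v \in V ->
  v = \sum_(i < size e) '[v, e`_i] *: e`_i.
Proof.
by move=> [/span_basis eV eon] vV; apply: orthonormal_expand; rewrite ?eV.
Qed.

(** The Gram-Schmidt process. *)
Lemma orthonormal_extend V s : orthonormal inner s -> {subset s <= V} ->
  exists t, orthonormal_basis V (s ++ t).
Proof.
have [m] := ubnP (\dim V - size s); elim: m s => // m IHm s;
  rewrite ltnS => sm son sV.
have sVs : (<< s >> <= V)%VS by apply/span_subvP.
have [Vs|/subvPn[v vV vs]] := boolP (V <= << s >>)%VS.
  exists [::]; rewrite cats0; split=> //.
  by rewrite basisEfree (orthonormal_free son) sVs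
    /= (leq_trans (dimvS Vs)) ?dim_span.
pose x := v - \sum_(i < size s) '[v, s`_i] *: s`_i.
have xsum : \sum_(i < size s) '[v, s`_i] *: s`_i \in << s >>%VS.
  by apply: rpred_sum => i _; rewrite rpredZ // memv_span // mem_nth.
have x0 : x != 0 by apply: contra vs; rewrite subr_eq0 => /eqP ->.
have xV : x \in V by rewrite rpredB // (subvP sVs).
have xs j : (j < size s)%N -> '[x, s`_j] = 0.
  move=> js; rewrite linearBl /=.
  by rewrite (inner_orthonormal_sum _ (Ordinal js) son) subrr.
have uon : orthonormal inner (rcons s (normalize x)).
  rewrite orthonormal_rcons inner_normalize // eqxx son andbT /=.
  by apply/(all_nthP 0) => i /xs xi; rewrite innerZl xi mulr0.
have uV : {subset rcons s (normalize x) <= V}.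
  by move=> y; rewrite mem_rcons inE => /predU1P[->|/sV//]; rewrite rpredZ.
have [|t tV] := IHm (rcons s (normalize x)) _ uon uV.
  rewrite size_rcons; have := orthonormal_free uon.
  move/eqP; rewrite size_rcons => us.
  have : (size s < \dim V)%N by rewrite -us dimvS //; apply/span_subvP.
  lia.
by exists (normalize x :: t); rewrite -cat_rcons.
Qed.

Lemma orthonormal_basis_exists V : exists e, orthonormal_basis V e.
Proof.
by have [] := @orthonormal_extend V [::]; last by move=> e; exists e.
Qed.

Lemma mem_perp V e v : orthonormal_basis V e ->
  (forall i, (i < size e)%N -> '[v, e`_i] = 0) -> v \in perp V.
Proof.
move=> eV ve; apply/mem_orthovP => w wV; rewrite -[LHS]/'[v, w].
rewrite (orthonormal_basis_expand eV wV) inner_sumr /= big1 // => i _.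
by rewrite innerZr ve // mulr0.
Qed.

Lemma inner_perp V u v : u \in V -> v \in perp V -> '[u, v] = 0.
Proof. by move=> uV /mem_orthovP/(_ u uV)/eqP; rewrite -inner_eq0C => /eqP. Qed.

Lemma sub_expand_perp V e v : orthonormal_basis V e ->
  v - \sum_(i < size e) '[v, e`_i] *: e`_i \in perp V.
Proof.
move=> eV; apply: (mem_perp eV) => j js; have [_ eon] := eV.
by rewrite linearBl /= (inner_orthonormal_sum _ (Ordinal js) eon) subrr.
Qed.

Lemma capv_perp V : (V :&: perp V = 0)%VS.
Proof.
apply/eqP; rewrite -subv0; apply/subvP => v /memv_capP[vV vp].
rewrite memv0 -sqnorm_eq0 -(fmorph_eq0 (@scal_of_real R k)) /= -inner_self.
by rewrite (inner_perp vV vp).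
Qed.

Lemma addv_perp V : (V + perp V = fullv)%VS.
Proof.
apply/eqP; rewrite eqEsubv subvf /=; apply/subvP => v _.
have [e eV] := orthonormal_basis_exists V.
rewrite -[v](subrK (\sum_(i < size e) '[v, e`_i] *: e`_i)) addrC memv_add //.
  by apply: rpred_sum => i _; rewrite rpredZ // (orthonormal_basis_mem _ eV).
exact: sub_expand_perp.
Qed.

Lemma dim_perp V : \dim (perp V) = (n - \dim V)%N.
Proof.
have := dimv_disjoint_sum (capv_perp V); rewrite addv_perp dimvf /dim /= mul1n.
by move=> nE; rewrite -(addKn (\dim V) (\dim (perp V))) -nE.
Qed.

Lemma dim_le V : (\dim V <= n)%N.
Proof. by have := dimvS (subvf V); rewrite dimvf /dim /= mul1n. Qed.

Lemma perpK : involutive perp.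
Proof.
move=> V; apply/esym/eqP; rewrite eqEdim !dim_perp subKn ?dim_le // leqnn andbT.
by apply/subvP => v vV; apply/mem_orthovP => w wV; exact: inner_perp vV wV.
Qed.

Lemma orthoproj_mem W v : orthoproj W v \in W.
Proof. exact: memv_pi. Qed.

Lemma orthoproj_perp W v : v - orthoproj W v \in perp W.
Proof.
rewrite -{1}(daddv_pi_add (capv_perp W) (w := v)) ?addv_perp ?memvf //.
by rewrite addrC addKr memv_pi.
Qed.

Lemma inner_orthoproj W u w : w \in W -> '[orthoproj W u, w] = '[u, w].
Proof.
move=> wW; apply/eqP; rewrite eq_sym -subr_eq0 -linearBl inner_eq0C.
by rewrite (inner_perp wW) // orthoproj_perp.
Qed.

(** Parseval's identity for the decomposition of the space into [W] and its
    orthogonal complement. *)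
Lemma parseval W f g u v :
  orthonormal_basis W f -> orthonormal_basis (perp W) g ->
  '[u, v] = \sum_(i < size f) '[u, f`_i] * '[f`_i, v]
            + \sum_(i < size g) '[u, g`_i] * '[g`_i, v].
Proof.
move=> fW gW; pose x := \sum_(i < size f) '[u, f`_i] *: f`_i.
have ux : u - x \in perp W by exact: sub_expand_perp.
rewrite -{1}[u](subrK x) addrC linearDl /= inner_suml; congr (_ + _).
  by apply: eq_bigr => i _; rewrite /= innerZl.
rewrite {1}(orthonormal_basis_expand gW ux) inner_suml /=;
  apply: eq_bigr => i _.
rewrite /= innerZl linearBl /= inner_suml big1 ?subr0 //= => j _.
rewrite innerZl (inner_perp (orthonormal_basis_mem j fW)) ?mulr0 //.
exact: orthonormal_basis_mem.
Qed.

End EuclideanSpace.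

(** * Principal angles *)

(** Sylvester's identity, by which [A *m B] and [B *m A] have the same nonzero
    eigenvalues. Let [M] be the block matrix with rows ['X, A] and [B, 1]. Column
    operations that clear [B] show that the determinant of [M] is
    [char_poly (A *m B)]. Row operations clear [B] once the lower rows have been
    multiplied by ['X]; hence ['X^m * \det M = 'X^p * char_poly (B *m A)]. *)
Lemma char_poly_mulC (K : comNzRingType) (p m : nat)
    (A : 'M[K]_(p, m)) (B : 'M[K]_(m, p)) :
  'X^m * char_poly (A *m B) = 'X^p * char_poly (B *m A).
Proof.
pose a := map_mx polyC A; pose b := map_mx polyC B.
pose M := block_mx 'X%:M a b 1%:M.
have detM : \det M = char_poly (A *m B).
  have := det_lblock (1%:M : 'M[{poly K}]_p) (- b) (1%:M : 'M[{poly K}]_m).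
  rewrite !det1 mulr1 => L1; rewrite -[LHS]mulr1 -L1 -det_mulmx mulmx_block.
  rewrite !mulmx1 !mulmx0 !mul1mx !add0r mulmxN subrr det_ublock det1 mulr1.
  by rewrite /char_poly /char_poly_mx map_mxM.
have := det_lblock (1%:M : 'M[{poly K}]_p) (- b) ('X%:M : 'M[{poly K}]_m).
rewrite det1 mul1r det_scalar => <-; rewrite -detM -det_mulmx mulmx_block.
rewrite !mul1mx !mul0mx !addr0 mulmx1 mulNmx mul_mx_scalar mul_scalar_mx addNr.
by rewrite det_ublock det_scalar addrC mulNmx /char_poly /char_poly_mx map_mxM.
Qed.

Lemma ler_acos (R : realType) (x y : R) :
  -1 <= x -> x <= y -> y <= 1 -> acos y <= acos x.
Proof.
move=> x1 xy y1; have xI : -1 <= x <= 1 by rewrite x1 (le_trans xy).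
have yI : -1 <= y <= 1 by rewrite y1 (le_trans x1).
rewrite leNgt; apply/negP => lt_acos; move: xy; apply/negP; rewrite -ltNge.
rewrite -[x]acosK ?in_itv //= -[y in y < _]acosK ?in_itv //=.
by rewrite ltr_cos ?in_itv /= ?acos_ge0 ?acos_lepi.
Qed.

Section PrincipalAngles.
Variables (R : realType) (k : scalars) (n : nat).
Local Notation F := (scal R k).
Local Notation E := 'rV[F]_n.
Local Notation conj := (@scal_conj R k).
Local Notation inner := (@inner R k n).
Local Notation "x %:F" := (scal_of_real k x).
Local Notation "''[' u , v ]" := (inner u v).
Local Notation perp := (@perp R k n).
Local Notation orthoproj := (@orthoproj R k n).
Implicit Types (u v w : E) (V W : {vspace E}) (e f g : seq E) (s : seq R).

Lemma orthonormal_basisI V e : orthonormal inner e -> {subset e <= V} ->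
  (\dim V <= size e)%N -> orthonormal_basis V e.
Proof.
by move=> eon /span_subvP eV Ve; split; rewrite // basisEfree
  orthonormal_free // eV.
Qed.

Lemma orthonormal_inP e : orthonormal inner e <->
  uniq e /\ {in e &, forall u v, '[u, v] = (u == v)%:R}.
Proof.
split=> [eon|[eu ein]]; last first.
  by apply/orthonormalP => i j ie je; rewrite ein ?mem_nth // nth_uniq.
have eu := free_uniq (orthonormal_free eon); split=> // u v /(nthP 0)[i ie <-].
by move=> /(nthP 0)[j je <-]; rewrite (orthonormal_nth eon) // nth_uniq.
Qed.

Lemma perm_orthonormal_basis V e f : perm_eq e f ->
  orthonormal_basis V e -> orthonormal_basis V f.
Proof.
move=> ef [eV /orthonormal_inP[eu ein]]; split.
  by rewrite -(perm_basis _ ef).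
apply/orthonormal_inP; split=> [|u v]; first by rewrite -(perm_uniq ef).
by rewrite -!(perm_mem ef); exact: ein.
Qed.

(** This is the spectral theorem for the Hermitian form [<P_W u, P_W v>] on [V],
    by induction on the dimension of [V]: an eigenvector [y] of this form is
    orthogonal, for the form as well, to the complement of [y] in [V]. *)
Lemma orthonormal_basis_diag V W : exists2 e, orthonormal_basis V e &
  {in e &, forall u v, u != v -> '[orthoproj W u, orthoproj W v] = 0}.
Proof.
have [m] := ubnP (\dim V); elim: m V => // m IHm V; rewrite ltnS => Vm.
have [e eV] := orthonormal_basis_exists V.
have [e0|e_gt0] := posnP (size e).
  by exists e => // u v; rewrite (size0nil e0).
pose H := \matrix_(i < size e, j < size e)
  '[orthoproj W e`_i, orthoproj W e`_j].
have Hherm i j : H i j = conj (H j i) by rewrite !mxE innerC.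
have [a /eigenvalueP[c cH c0]] := hermitian_eigenvalue e_gt0 Hherm.
pose x := \sum_(i < size e) c 0 i *: e`_i.
have eon : orthonormal inner e by case: eV.
have xe (j : 'I_(size e)) : '[x, e`_j] = c 0 j.
  exact: inner_orthonormal_sum.
have xV : x \in V.
  by apply: rpred_sum => i _; rewrite rpredZ // (orthonormal_basis_mem _ eV).
have x0 : x != 0.
  apply: contra c0 => /eqP x0; apply/eqP/rowP => j.
  by rewrite -xe x0 linear0l mxE.
have Px : orthoproj W x = \sum_(i < size e) c 0 i *: orthoproj W e`_i.
  by rewrite linear_sum; apply: eq_bigr => i _; rewrite linearZ.
clearbody x.
have xP u : u \in V -> '[orthoproj W x, orthoproj W u] = a * '[x, u].
  move=> uV; rewrite (orthonormal_basis_expand eV uV) linear_sum /=.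
  rewrite !inner_sumr mulr_sumr; apply: eq_bigr => j _ /=.
  rewrite linearZ /= !innerZr mulrCA xe; congr (_ * _).
  have /rowP/(_ j) := cH; rewrite !mxE => <-.
  rewrite Px inner_suml; apply: eq_bigr => i _ /=.
  by rewrite innerZl mxE.
pose y := normalize x.
have yV : y \in V by rewrite rpredZ.
have yP u : u \in V -> '[y, u] = 0 -> '[orthoproj W y, orthoproj W u] = 0.
  by move=> uV; rewrite /y linearZ /= !innerZl xP // mulrCA => ->;
    rewrite mulr0.
pose V' := (V :&: orthov inner <[y]>)%VS.
have V'P u : u \in V' -> u \in V /\ '[y, u] = 0.
  rewrite memv_cap mem_orthov1 => /andP[uV uy]; split=> //.
  by apply/eqP; rewrite inner_eq0C.
have V'V : (\dim V' < m)%N.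
  apply: leq_trans Vm; rewrite ltnNge; apply/negP => VV'.
  have /V'P[_] : y \in V'.
    suff /eqP -> : V' == V by [].
    by rewrite eqEdim VV' andbT; apply/subvP => u /V'P[].
  by rewrite inner_normalize // => /eqP; rewrite oner_eq0.
have [f fV' fP] := IHm _ V'V.
have fV u : u \in f -> u \in V /\ '[y, u] = 0.
  by move=> uf; apply: V'P; have [fb _] := fV'; exact: (basis_mem fb).
exists (y :: f).
  apply: orthonormal_basisI.
  - rewrite orthonormal_cons inner_normalize // eqxx /=; apply/andP; split.
      by apply/allP => u /fV[_ ->].
    by case: fV'.
  - by move=> u; rewrite inE => /predU1P[->//|/fV[]].
  - rewrite /= (orthonormal_basis_size fV').
    by have := leq_dim_orthov1 inner y V; rewrite -/V'; case: (\dim V).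
move=> u v; rewrite !inE => /predU1P[->|uf] /predU1P[->|vf]; rewrite ?eqxx //.
- by have [vV yv] := fV _ vf; move=> _; exact: yP.
- by have [uV yu] := fV _ uf; move=> _; apply/eqP; rewrite inner_eq0C yP.
- exact: fP.
Qed.

(** The vectors [P_W u], for [u] in an orthonormal basis
    of [V] that diagonalizes [<P_W u, P_W v>], are orthogonal. Once they are sorted
    by decreasing norm, those that do not vanish yield, after normalization, the
    beginning of the required basis of [W]. *)
Lemma singular_values_exist V W : (\dim V <= \dim W)%N ->
  exists s, is_singular_values V W (orthoproj W) s.
Proof.
move=> VW; have [e0 e0V e0P] := orthonormal_basis_diag V W.
pose N u := sqnorm (orthoproj W u); pose ge u v := N v <= N u.
pose e := sort ge e0; have e0e : perm_eq e0 e by rewrite perm_sym perm_sort.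
have eV := perm_orthonormal_basis e0e e0V.
have [eb eon] := eV; have eu := free_uniq (orthonormal_free eon).
have eP i j : (i < size e)%N -> (j < size e)%N -> i != j ->
    '[orthoproj W e`_i, orthoproj W e`_j] = 0.
  by move=> ie je ij; apply: e0P; rewrite ?(perm_mem e0e) ?mem_nth // nth_uniq.
have ge_trans : transitive ge by move=> v u w uv vw; exact: le_trans vw uv.
have esorted : sorted ge e by apply: sort_sorted => u v; exact: le_total.
(* The projections vanish exactly from index [r] on. *)
pose r := find (fun u => N u == 0) e.
have re : (r <= size e)%N by exact: find_size.
have e_lt i : (i < r)%N -> orthoproj W e`_i != 0.
  by move=> ir; rewrite -sqnorm_eq0; have /negbT := before_find 0 ir.
have e_ge i : (r <= i)%N -> orthoproj W e`_i = 0.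
  move=> ri; have [ie|ie] := ltnP i (size e);
    last by rewrite nth_default // linear0.
  have rlt := leq_ltn_trans ri ie.
  have /eqP er0 : N e`_r == 0.
    by apply: (@nth_find _ 0 (fun u => N u == 0)); rewrite has_find.
  apply/eqP; rewrite -sqnorm_eq0 eq_le sqnorm_ge0 andbT -[X in _ <= X]er0.
  by apply: (sorted_leq_nth ge_trans _ _ esorted) => // u; exact: lexx.
pose f0 := [seq normalize (orthoproj W u) | u <- take r e].
have f0s : size f0 = r by rewrite size_map size_takel.
have f0E i : (i < r)%N -> f0`_i = normalize (orthoproj W e`_i).
  by move=> ir; rewrite (nth_map 0) ?size_takel // nth_take.
have f0on : orthonormal inner f0.
  apply/orthonormalP => i j; rewrite f0s => ir jr; rewrite !f0E //.
  have [<-|ij] := eqVneq i j; first by rewrite inner_normalize ?e_lt.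
  by rewrite innerZl innerZr eP ?mulr0 // (leq_trans _ re).
have [|t fW] := @orthonormal_extend _ _ _ W f0 f0on.
  by move=> _ /mapP[u _ ->]; rewrite rpredZ // orthoproj_mem.
have [fb fon] := fW; have fs := orthonormal_basis_size fW.
exists [seq Num.sqrt (N u) | u <- e]; split.
- by rewrite size_map (orthonormal_basis_size eV) (minn_idPl VW).
- rewrite sorted_map; apply: sub_sorted esorted => u v uv.
  by rewrite /= /relpre /= ler_sqrt ?sqnorm_ge0.
- by apply/allP => _ /mapP[u _ ->]; exact: sqrtr_ge0.
exists e, (f0 ++ t); split=> // i j.
rewrite -(orthonormal_basis_size eV) => ie jW.
rewrite (nth_map 0) //; have [ri|ir] := leqP r i.
  have /eqP N0 : sqnorm (0 : E) == 0 by rewrite sqnorm_eq0.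
  by rewrite /N e_ge // linear0l N0 sqrtr0 rmorph0 mul0rn.
rewrite [orthoproj W _]normalizeK innerZl -(f0E _ ir) -mulr_natr; congr (_ * _).
have -> : f0`_i = (f0 ++ t)`_i by rewrite nth_cat f0s ir.
by rewrite (orthonormal_nth fon) // fs // (leq_trans _ VW) //
  -(orthonormal_basis_size eV).
Qed.

Section SingularValues.
Variables (V W : {vspace E}) (s : seq R).
Hypothesis VW : (\dim V <= \dim W)%N.
Hypothesis sP : is_singular_values V W (orthoproj W) s.

Lemma singular_values_size : size s = \dim V.
Proof. by have [-> _ _ _] := sP; apply/minn_idPl. Qed.

Lemma singular_values_basis : exists e f, [/\ orthonormal_basis V e,
  orthonormal_basis W f & forall i j, (i < size e)%N -> (j < size f)%N ->
    '[e`_i, f`_j] = (s`_i)%:F *+ (i == j)].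
Proof.
have [_ _ _ [e [f [eV fW ef]]]] := sP; exists e, f; split=> // i j.
rewrite (orthonormal_basis_size eV) (orthonormal_basis_size fW) => ie jf.
by rewrite -ef // inner_orthoproj // (orthonormal_basis_mem _ fW).
Qed.

(** The singular values are inner products [<e_i, f_i>] of unit vectors, and
    [2 - 2 <e_i, f_i>] is the squared norm of [e_i - f_i]. *)
Lemma singular_values_itv x : x \in s -> 0 <= x <= 1.
Proof.
have [_ _ /allP s_ge0 _] := sP; move=> xs; rewrite s_ge0 //=.
move/(nthP 0): xs => [i is_ <-].
have [e [f [eV fW ef]]] := singular_values_basis.
have ie : (i < size e)%N.
  by rewrite (orthonormal_basis_size eV) -singular_values_size.
have if_ : (i < size f)%N.
  by rewrite (orthonormal_basis_size fW) (leq_trans _ VW) //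
    -(orthonormal_basis_size eV).
have [[_ eon] [_ fon]] := (eV, fW).
have : sqnorm (e`_i - f`_i) = 1 - s`_i + (1 - s`_i).
  apply: (fmorph_inj (@scal_of_real R k)) => /=; rewrite -inner_self.
  rewrite linearBl /= !linearBr /=.
  rewrite !(orthonormal_nth eon, orthonormal_nth fon) //.
  rewrite [X in _ - (X - _)]innerC ef // eqxx mulr1n scal_conj_real.
  by rewrite rmorphD !rmorphB rmorph1 opprB.
by have := sqnorm_ge0 (e`_i - f`_i) => /[swap] ->; lra.
Qed.

End SingularValues.

(** The left-hand side is the Gram matrix of the components of [e] orthogonal to
    [W]. By Parseval's identity it is the identity minus the Gram matrix of the
    components in [W], which are the vectors [s_i f_i]. *)
Lemma gram_perp V W e f g s : (size e <= size f)%N ->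
  orthonormal_basis V e -> orthonormal_basis W f ->
  (forall i j, (i < size e)%N -> (j < size f)%N ->
    '[e`_i, f`_j] = (s`_i)%:F *+ (i == j)) ->
  orthonormal_basis (perp W) g ->
  forall i j, (i < size e)%N -> (j < size e)%N ->
    \sum_(l < size g) '[e`_i, g`_l] * '[g`_l, e`_j]
      = (1 - s`_i ^+ 2)%:F *+ (i == j).
Proof.
move=> sef [_ eon] fW ef gW i j ie je.
have := parseval e`_i e`_j fW gW.
rewrite (orthonormal_nth eon) // addrC => /eqP; rewrite -subr_eq => /eqP <-.
have if_ := leq_trans ie sef.
rewrite (bigD1 (Ordinal if_)) //= big1 => [|l li]; last first.
  by rewrite ef // eq_sym (negPf (li : l != i :> nat)) mul0r.
rewrite addr0 ef // eqxx mulr1n innerC ef // rmorphMn /= scal_conj_real.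
rewrite [j == i]eq_sym; have [->|_] := eqVneq i j;
  last by rewrite /= !mulr0n mulr0 subr0.
by rewrite /= !mulr1n rmorphB rmorph1 rmorphXn expr2.
Qed.

(** Apart from zeros, both lists consist of the eigenvalues of the products, in
    either order, of the matrix [A] of inner products between principal vectors
    of [V] and of the complement of [W], and its adjoint [B]. The zeros make up
    for the different sizes of these products. *)
Lemma perp_singular_values V W s s' : (\dim V <= \dim W)%N ->
  is_singular_values V W (orthoproj W) s ->
  is_singular_values (perp W) (perp V) (orthoproj (perp V)) s' ->
  perm_eq ([seq 1 - x ^+ 2 | x <- s] ++ nseq (\dim (perp W)) 0)
          ([seq 1 - x ^+ 2 | x <- s'] ++ nseq (\dim V) 0).
Proof.
move=> VW sP s'P; have WV : (\dim (perp W) <= \dim (perp V))%N.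
  by rewrite !dim_perp leq_sub2l.
have [e [f [eV fW ef]]] := singular_values_basis sP.
have [g [h [gW hV gh]]] := singular_values_basis s'P.
have ss := singular_values_size VW sP; have ss' := singular_values_size WV s'P.
have se := orthonormal_basis_size eV; have sf := orthonormal_basis_size fW.
have sg := orthonormal_basis_size gW; have sh := orthonormal_basis_size hV.
have eV' : orthonormal_basis (perp (perp V)) e by rewrite perpK.
have AB := gram_perp _ eV fW ef gW; have BA := gram_perp _ gW hV gh eV'.
rewrite se sf VW in AB; rewrite sg sh WV in BA.
have {}AB := AB isT; have {}BA := BA isT.
rewrite -se -sg in AB BA *.
pose A := \matrix_(i < size e, j < size g) '[e`_i, g`_j].
pose B := \matrix_(i < size g, j < size e) '[g`_i, e`_j].
pose diag m (t : seq R) : 'M[F]_m :=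
  \matrix_(i, j) ((1 - t`_i ^+ 2)%:F *+ (i == j)).
have ABE : A *m B = diag (size e) s.
  apply/matrixP => i j; rewrite !mxE -val_eqE /= -AB //.
  by apply: eq_bigr => l _; rewrite !mxE.
have BAE : B *m A = diag (size g) s'.
  apply/matrixP => i j; rewrite !mxE -val_eqE /= -BA //.
  by apply: eq_bigr => l _; rewrite !mxE.
have char_diag m t : size t = m ->
    char_poly (diag m t)
    = \prod_(x <- [seq (1 - x ^+ 2)%:F | x <- t]) ('X - x%:P).
  move=> tm; rewrite char_poly_trig; last first.
    by apply/is_trig_mxP => i j ij; rewrite mxE -val_eqE /= (ltn_eqF ij) mulr0n.
  rewrite big_map (big_nth 0) tm big_mkord; apply: eq_bigr => i _.
  by rewrite !mxE eqxx mulr1n.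
have := char_poly_mulC A B; rewrite ABE BAE !char_diag ?sg ?se //.
have Xn m : 'X^m = \prod_(x <- nseq m (0 : F)) ('X - x%:P).
  by rewrite big_nseq subr0; elim: m => [|m IHm]; rewrite ?expr0 ?exprS ?IHm.
rewrite 2!Xn ![_ * \prod_(x <- map _ _) _]mulrC -!big_cat => /prod_XsubC_eq.
rewrite -(rmorph0 (@scal_of_real R k)) -!map_nseq.
rewrite ![[seq _ | x <- s]](map_comp (@scal_of_real R k)).
rewrite ![[seq _ | x <- s']](map_comp (@scal_of_real R k)).
rewrite -!map_cat.
by move/(perm_map_inj (fmorph_inj (@scal_of_real R k))).
Qed.

Lemma singular_valuesP V W : (\dim V <= \dim W)%N ->
  is_singular_values V W (orthoproj W) (singular_values V W (orthoproj W)).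
Proof.
by move=> /singular_values_exist[s sP]; apply: (xgetPex [::]); exists s.
Qed.

Lemma principal_angles_size V W : (\dim V <= \dim W)%N ->
  size (principal_angles V W) = \dim V.
Proof.
by move=> VW; rewrite size_map (singular_values_size VW (singular_valuesP VW)).
Qed.

Lemma principal_angles_itv V W x : (\dim V <= \dim W)%N ->
  x \in principal_angles V W -> 0 <= x <= pi / 2.
Proof.
move=> VW /mapP[y ys ->].
have /andP[y0 y1] := singular_values_itv VW (singular_valuesP VW) ys.
by rewrite acos_ge0 ?(le_trans _ y0) ?lerN10 // -acos0 ler_acos ?lerN10.
Qed.

Lemma principal_angles_sorted V W : (\dim V <= \dim W)%N ->
  sorted <=%R (principal_angles V W).
Proof.
move=> VW; have sP := singular_valuesP VW; have [_ ssorted _ _] := sP.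
rewrite sorted_map; apply: (sub_in_sorted _ (allss _) ssorted) => x y.
move=> /(singular_values_itv VW sP)/andP[x0 x1].
move=> /(singular_values_itv VW sP)/andP[y0 y1] yx.
by apply: ler_acos; rewrite // (le_trans _ y0) ?lerN10.
Qed.

(** An angle between [0] and [pi / 2] is a function of its squared sine, and this
    function maps zero to zero. *)
Lemma perp_principal_angles V W : (\dim V <= \dim W)%N ->
  perm_eq [seq x <- principal_angles V W | x != 0]
          [seq x <- principal_angles (perp W) (perp V) | x != 0].
Proof.
move=> VW; have WV : (\dim (perp W) <= \dim (perp V))%N.
  by rewrite !dim_perp leq_sub2l.
have sP := singular_valuesP VW; have s'P := singular_valuesP WV.
pose a (x : R) := acos (Num.sqrt (1 - x)).
have a0 : a 0 = 0 by rewrite /a subr0 sqrtr1 acos1.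
have aE (t : seq R) m : {in t, forall x, 0 <= x} ->
    [seq x <- [seq a x | x <- [seq 1 - x ^+ 2 | x <- t] ++ nseq m 0] | x != 0]
    = [seq x <- [seq acos x | x <- t] | x != 0].
  move=> t_ge0; rewrite map_cat filter_cat map_nseq a0 filter_nseq eqxx cats0
    -map_comp.
  congr seq.filter; apply/eq_in_map => x /t_ge0 x0.
  by rewrite /a /= opprB addrCA subrr addr0 sqrtr_sqr ger0_norm.
have := perm_map a (perp_singular_values VW sP s'P).
move=> /(perm_filter (fun x => x != 0)); rewrite !aE //.
  by move=> x /(singular_values_itv WV s'P)/andP[].
by move=> x /(singular_values_itv VW sP)/andP[].
Qed.

(** If [V] is contained in [W] then [e_i = P_W e_i = s_i f_i], so that the
    nonnegative number [s_i] is of modulus [1]. *)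
Lemma principal_angles_sub V W : (V <= W)%VS ->
  {in principal_angles V W, forall x, x = 0}.
Proof.
move=> sVW; have VW := dimvS sVW; have sP := singular_valuesP VW.
move=> _ /mapP[x xs ->]; have /andP[x0 x1] := singular_values_itv VW sP xs.
have [e [f [eV fW ef]]] := singular_values_basis sP.
move/(nthP 0): xs => [i is_ ix].
have ie : (i < size e)%N.
  by rewrite (orthonormal_basis_size eV) -(singular_values_size VW sP).
have if_ : (i < size f)%N.
  by rewrite (orthonormal_basis_size fW) (leq_trans _ VW) //
    -(orthonormal_basis_size eV).
have eiW : e`_i \in W by rewrite (subvP sVW) ?(orthonormal_basis_mem _ eV).
have eE : e`_i = x%:F *: f`_i.
  rewrite (orthonormal_basis_expand fW eiW).
  rewrite (bigD1 (Ordinal if_)) //= big1 => [|l li].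
    by rewrite ef // eqxx mulr1n ix addr0.
  by rewrite ef // eq_sym (negPf (li : l != i :> nat)) mulr0n scale0r.
have [[_ eon] [_ fon]] := (eV, fW).
have := orthonormal_nth eon ie ie.
rewrite eE innerZl innerZr (orthonormal_nth fon) // !eqxx mulr1 scal_conj_real.
rewrite -rmorphM -[RHS](rmorph1 (@scal_of_real R k)) => /fmorph_inj/eqP.
rewrite -expr2 sqrf_eq1 => /orP[]/eqP xE; first by rewrite xE acos1.
by move: x0; rewrite xE oppr_ge0 ler10.
Qed.

End PrincipalAngles.

(** * The distances *)

Section Distance.
Variables (R : realType) (k : scalars) (n : nat) (d : metric).
Local Notation Gr := (Gr R k n).
Local Notation perp := (@perp R k n).
Local Notation dist := (@dist R k n d).
Implicit Types (V W U : Gr) (theta : seq R).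

Lemma big_nonzero (T : Type) (idx : T) (op : Monoid.com_law idx)
    (phi : R -> T) theta :
  phi 0 = idx ->
  \big[op/idx]_(i < size theta) phi theta`_i
    = \big[op/idx]_(x <- [seq x <- theta | x != 0]) phi x.
Proof.
move=> phi0; rewrite big_filter [RHS]big_mkcond (big_nth 0) big_mkord.
by apply: eq_bigr => i _; case: eqP => //= ->.
Qed.

Lemma ler_last theta theta' : sorted <=%R theta' ->
  (forall x, x \in theta' -> 0 <= x) ->
  {subset [seq x <- theta | x != 0] <= theta'} ->
  theta`_(size theta).-1 <= theta'`_(size theta').-1.
Proof.
move=> theta'_sorted theta'_ge0 sub; set x := theta`__.
have [x0|x_neq0] := eqVneq x 0.
  rewrite x0; case: theta' theta'_ge0 {theta'_sorted sub} => // y t t_ge0.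
  by apply: t_ge0; rewrite mem_nth.
have [tn|t_gt0] := posnP (size theta).
  by move: x_neq0; rewrite /x nth_default ?tn ?eqxx.
have /sub/(nthP 0)[i ilt <-] : x \in [seq x <- theta | x != 0].
  by rewrite mem_filter x_neq0 mem_nth ?prednK.
have t'_gt0 := leq_ltn_trans (leq0n i) ilt.
apply: (sorted_leq_nth le_trans) => //; rewrite ?inE ?prednK //.
by rewrite -ltnS prednK.
Qed.

(** Each of the nine expressions depends on a sum, on a product, or on the maximum
    of the angles, which comes last in the sorted list. A zero angle contributes
    to none of these. *)
Lemma dist_of_angles_perm theta theta' :
  sorted <=%R theta -> sorted <=%R theta' ->
  (forall x, x \in theta -> 0 <= x) -> (forall x, x \in theta' -> 0 <= x) ->
  perm_eq [seq x <- theta | x != 0] [seq x <- theta' | x != 0] ->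
  dist_of_angles d (size theta) theta = dist_of_angles d (size theta') theta'.
Proof.
move=> st st' t_ge0 t'_ge0 tt'.
have lastE : theta`_(size theta).-1 = theta'`_(size theta').-1.
  apply/le_anti/andP; split; apply: ler_last => // x.
    by rewrite (perm_mem tt') mem_filter => /andP[].
  by rewrite -(perm_mem tt') mem_filter => /andP[].
have bigE (T : Type) (idx : T) (op : Monoid.com_law idx) (phi : R -> T) :
    phi 0 = idx ->
    \big[op/idx]_(i < size theta) phi theta`_i
      = \big[op/idx]_(i < size theta') phi theta'`_i.
  by move=> phi0; rewrite !big_nonzero // (perm_big _ tt').
case: d => /=; rewrite ?lastE //.
- by rewrite (bigE _ _ _ (fun x => x ^+ 2)) ?expr0n.
- by rewrite (bigE _ _ _ (fun x => sin (x / 2) ^+ 2)) // mul0r sin0 expr0n.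
- by rewrite (bigE _ _ _ (fun x => sin x ^+ 2)) // sin0 expr0n.
- by rewrite (bigE _ _ _ cos) // cos0.
- by rewrite (bigE _ _ _ cos) // cos0.
- by rewrite (bigE _ _ _ (fun x => cos x ^+ 2)) // cos0 expr1n.
Qed.

Lemma dist_of_angles_nil : dist_of_angles d 0 [::] = 0 :> R.
Proof.
by case: d; rewrite /= ?big_ord0 ?sqrtr0 ?mulr0 ?acos1 ?mulr1 ?subrr ?sqrtr0
  ?mul0r ?sin0 ?mulr0.
Qed.

(** If [V] is zero there are no angles, and then all nine expressions vanish. *)
Lemma dist_angles V W : (\dim V <= \dim W)%N ->
  dist V W
  = dist_of_angles d (size (principal_angles V W)) (principal_angles V W).
Proof.
move=> VW; rewrite /dist ltnNge VW /= principal_angles_size //;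
  case: eqP => // V0.
have := principal_angles_size VW; rewrite V0 => /size0nil ->.
by rewrite dist_of_angles_nil.
Qed.

Lemma dist_Delta V W : (\dim W < \dim V)%N -> dist V W = Delta R d (\dim V).
Proof. by move=> WV; rewrite /dist WV; case: (\dim V) WV. Qed.

Lemma principal_angles_ge0 V W : (\dim V <= \dim W)%N ->
  forall x, x \in principal_angles V W -> 0 <= x.
Proof. by move=> VW x /(principal_angles_itv VW)/andP[]. Qed.

(** The two pairs have the same nonzero principal angles, on which alone the
    distance depends. *)
Lemma dist_perp V W : (\dim V <= \dim W)%N -> dist (perp W) (perp V) = dist V W.
Proof.
move=> VW; have WV : (\dim (perp W) <= \dim (perp V))%N.
  by rewrite !dim_perp leq_sub2l.
rewrite !dist_angles //; apply: dist_of_angles_perm.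
- exact: principal_angles_sorted.
- exact: principal_angles_sorted.
- exact: principal_angles_ge0.
- exact: principal_angles_ge0.
- by rewrite perm_sym perp_principal_angles.
Qed.

Lemma dist_sub V W : (V <= W)%VS -> dist V W = 0.
Proof.
move=> sVW; have VW := dimvS sVW; rewrite dist_angles //
  -[RHS]dist_of_angles_nil.
apply: (@dist_of_angles_perm _ [::]) => //.
- exact: principal_angles_sorted.
- exact: principal_angles_ge0.
rewrite (_ : [seq x <- _ | _] = [::]) //; apply/eqP;
  rewrite -size_eq0 size_filter.
rewrite eqn0Ngt -has_count; apply/negP.
move=> /hasP[x /(principal_angles_sub sVW) ->].
by rewrite eqxx.
Qed.

Lemma Delta_gt0 p : (0 < p)%N -> 0 < Delta R d p.
Proof.
move=> p0; have pi2 : 0 < pi / 2 :> R by rewrite divr_gt0 ?pi_gt0.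
have p0' : 0 < p%:R :> R by rewrite ltr0n.
case: d => //=; rewrite ?sqrtr_gt0 //; last by rewrite mulr_gt0.
by rewrite mulr_gt0 ?sqrtr_gt0.
Qed.

Lemma Delta_ge0 p : 0 <= Delta R d p.
Proof.
have pi2 : 0 <= pi / 2 :> R by rewrite divr_ge0 ?pi_ge0.
by case: d => //=; rewrite ?sqrtr_ge0 // mulr_ge0 ?sqrtr_ge0.
Qed.

Lemma Delta_le p q : (p <= q)%N -> Delta R d p <= Delta R d q.
Proof.
have pi2 : 0 <= pi / 2 :> R by rewrite divr_ge0 ?pi_ge0.
move=> pq; have pq' : p%:R <= q%:R :> R by rewrite ler_nat.
case: d => //=; last by rewrite ler_wsqrtr.
- by rewrite ler_wpM2l ?ler_wsqrtr.
- by rewrite ler_wsqrtr // ler_wpM2l.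
Qed.

(** By the half-angle formula, the left-hand side is [1 - cos x]. *)
Lemma sqr_sin_half (x : R) : 0 <= x <= pi / 2 -> 2 * sin (x / 2) ^+ 2 <= 1.
Proof.
move=> /andP[x0 x1]; have : 0 <= cos x.
  by rewrite cos_ge0_pihalf // x1 (le_trans _ x0) // oppr_le0 divr_ge0 ?pi_ge0.
have -> : cos x = 1 - 2 * sin (x / 2) ^+ 2.
  set y := x / 2; have -> : x = y *+ 2 by rewrite -mulr_natr divfK.
  by rewrite cos_mulr2n cos2sin2; ring.
by rewrite subr_ge0.
Qed.

Lemma dist_of_angles_le theta : (0 < size theta)%N ->
  (forall x, x \in theta -> 0 <= x <= pi / 2) ->
  dist_of_angles d (size theta) theta <= Delta R d (size theta).
Proof.
set p := size theta => p0 t_itv.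
have pi2 : 0 <= pi / 2 :> R by rewrite divr_ge0 ?pi_ge0.
have ti i : 0 <= theta`_i <= pi / 2.
  have [ip|ip] := ltnP i p; first by rewrite t_itv ?mem_nth.
  by rewrite nth_default // lexx.
have cos_itv i : 0 <= cos theta`_i <= 1.
  have /andP[i0 i1] := ti i.
  by rewrite cos_le1 cos_ge0_pihalf // i1 (le_trans _ i0) // oppr_le0.
have cos_prod : 0 <= \prod_(i < p) cos theta`_i <= 1.
  rewrite prodr_ge0 => [|i _]; [exact: prodr_ile1|by case/andP: (cos_itv i)].
have sum_le (phi : R -> R) c : (forall i, phi theta`_i <= c) ->
    \sum_(i < p) phi theta`_i <= c * p%:R.
  move=> phi_le; apply: (le_trans (ler_sum _ (fun (i : 'I_p) _ => phi_le i))).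
  by rewrite sumr_const card_ord mulr_natr.
have sqr2 (x : R) : 0 <= x -> x = Num.sqrt (x ^+ 2).
  by move=> x0; rewrite sqrtr_sqr ger0_norm.
case: d => /=.
- rewrite [X in _ <= X](_ : _ = Num.sqrt ((pi / 2) ^+ 2 * p%:R)); last first.
    by rewrite sqrtrM ?sqr_ge0 // -sqr2.
  rewrite ler_wsqrtr // (sum_le (fun x => x ^+ 2)) // => i.
  by have /andP[i0 i1] := ti i; rewrite lerXn2r ?nnegrE.
- rewrite [X in X * _]sqr2 // -sqrtrM ?sqr_ge0 // ler_wsqrtr //.
  rewrite expr2 -mulrA ler_wpM2l // mulr_sumr -[X in _ <= X]mul1r.
  rewrite (sum_le (fun x => 2 * sin (x / 2) ^+ 2)) // => i.
  exact: sqr_sin_half.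
- rewrite ler_wsqrtr // -[X in _ <= X]mul1r (sum_le (fun x => sin x ^+ 2)) //.
- have /andP[c0 c1] := cos_prod; rewrite -[X in _ <= X]acos0.
  by rewrite ler_acos // lerN10.
- by rewrite ler_wsqrtr // gerBl mulr_ge0 //; case/andP: cos_prod.
- rewrite -[X in _ <= X]sqrtr1 ler_wsqrtr // gerBl.
  by apply: prodr_ge0 => i _; exact: sqr_ge0.
- by case/andP: (ti p.-1).
- have /andP[x0 x1] := ti p.-1; set x := theta`__ in x0 x1 *.
  have s0 : 0 <= sin (x / 2).
    apply: sin_ge0_pi; rewrite divr_ge0 //=; have := @pi_ge0 R; lra.
  rewrite [X in X <= _]sqr2 ?mulr_ge0 // ler_wsqrtr // exprMn expr2 -mulrA.
  by rewrite -[X in _ <= X]mulr1 ler_wpM2l // sqr_sin_half // x0 x1.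
- exact: sin_le1.
Qed.

Lemma dist_le_Delta V W : dist V W <= Delta R d (\dim V).
Proof.
have [V0|V_gt0] := posnP (\dim V); first by rewrite /dist V0 Delta_ge0.
have [VW|WV] := leqP (\dim V) (\dim W); last by rewrite dist_Delta.
rewrite dist_angles // -[X in Delta R d X](principal_angles_size VW).
apply: dist_of_angles_le; first by rewrite principal_angles_size.
by move=> x; exact: principal_angles_itv.
Qed.

End Distance.

(** * The topologies generated by balls *)

Section BallTopologies.
Variables (R : realType) (k : scalars) (n : nat) (d : metric).
Local Notation Gr := (Gr R k n).
Local Notation perp := (@perp R k n).
Local Notation dist := (@dist R k n d).
Local Notation Delta := (@Delta R d).
Local Notation Gr_minus := (Gr_minus R k n d).
Local Notation Gr_plus := (Gr_plus R k n d).
Local Notation Gr_sym := (Gr_sym R k n d).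
Implicit Types (U V W : Gr).

Lemma open_finI (X : topologicalType) (I : choiceType) (b : I -> set X)
    (D : {fset I}) :
  (forall i, i \in D -> open (b i)) -> open (\bigcap_(i in [set` D]) b i).
Proof.
move=> bo; rewrite openE => x bx; apply: filter_bigI => i iD.
by apply: open_nbhs_nbhs; split; [exact: bo|exact: bx].
Qed.

Lemma open_minus_ball V (r : R) : 0 < r ->
  open ([set U | dist U V < r] : set Gr_minus).
Proof.
move=> r0; exists [set [set U | dist U V < r]]; last by rewrite bigcup_set1.
move=> _ ->; exists [fset (V, r)]%fset.
  by move=> i; rewrite in_fset1 => /eqP ->; rewrite inE.
by rewrite set_fset1 bigcap_set1.
Qed.

Lemma open_plus_ball V (r : R) : 0 < r ->
  open ([set U | dist V U < r] : set Gr_plus).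
Proof.
move=> r0; exists [set [set U | dist V U < r]]; last by rewrite bigcup_set1.
move=> _ ->; exists [fset (V, r)]%fset.
  by move=> i; rewrite in_fset1 => /eqP ->; rewrite inE.
by rewrite set_fset1 bigcap_set1.
Qed.

Lemma open_sym_ball V (r : R) : 0 < r ->
  open ([set U | Num.max (dist U V) (dist V U) < r] : set Gr_sym).
Proof.
move=> r0; exists [set [set U | Num.max (dist U V) (dist V U) < r]].
  move=> _ ->; exists [fset (V, r)]%fset.
    by move=> i; rewrite in_fset1 => /eqP ->; rewrite inE.
  by rewrite set_fset1 bigcap_set1.
by rewrite bigcup_set1.
Qed.

Lemma continuous_minus (X : topologicalType) (f : X -> Gr_minus) :
  (forall V (r : R), 0 < r -> open [set x | dist (f x) V < r]) -> continuous f.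
Proof.
move=> fo; apply/continuousP => _ [D' sD' <-]; rewrite preimage_bigcup.
apply: bigcup_open => _ /sD'[D sD <-]; rewrite preimage_bigcap.
by apply: open_finI => i /sD; rewrite inE; exact: fo.
Qed.

Lemma continuous_plus (X : topologicalType) (f : X -> Gr_plus) :
  (forall V (r : R), 0 < r -> open [set x | dist V (f x) < r]) -> continuous f.
Proof.
move=> fo; apply/continuousP => _ [D' sD' <-]; rewrite preimage_bigcup.
apply: bigcup_open => _ /sD'[D sD <-]; rewrite preimage_bigcap.
by apply: open_finI => i /sD; rewrite inE; exact: fo.
Qed.

Lemma continuous_sym (X : topologicalType) (f : X -> Gr_sym) :
  (forall V (r : R), 0 < r ->
    open [set x | Num.max (dist (f x) V) (dist V (f x)) < r]) -> continuous f.
Proof.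
move=> fo; apply/continuousP => _ [D' sD' <-]; rewrite preimage_bigcup.
apply: bigcup_open => _ /sD'[D sD <-]; rewrite preimage_bigcap.
by apply: open_finI => i /sD; rewrite inE; exact: fo.
Qed.

Lemma dist_refl V : dist V V = 0.
Proof. exact/dist_sub/subvv. Qed.

(** A small ball of [tau^-] around [V] contains no subspace of dimension greater
    than [\dim V], as those are at distance at least [Delta (\dim V).+1] from
    [V]. *)
Lemma open_minus_dim_le q : open ([set U | (\dim U <= q)%N] : set Gr_minus).
Proof.
rewrite (_ : mkset _ = \bigcup_(V in [set V | (\dim V <= q)%N])
  [set U | dist U V < Delta (\dim V).+1]).
  by apply: bigcup_open => V _; apply/open_minus_ball/Delta_gt0.
apply/seteqP; split=> [U Uq|U [V Vq /=]].
  by exists U; rewrite //= dist_refl Delta_gt0.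
move=> UV; rewrite (leq_trans _ Vq) // leqNgt; apply/negP => VU.
by move: UV; rewrite dist_Delta // ltNge Delta_le.
Qed.

(** The radius [Delta (\dim V)] would do, were it not for [V = 0], where it may
    vanish; there any positive radius is suitable. *)
Lemma open_plus_dim_ge q : open ([set U | (q <= \dim U)%N] : set Gr_plus).
Proof.
rewrite (_ : mkset _ = \bigcup_(V in [set V | (q <= \dim V)%N])
  [set U | dist V U < Delta (maxn 1 (\dim V))]).
  apply: bigcup_open => V _; apply: open_plus_ball.
  by rewrite Delta_gt0 // leq_maxl.
apply/seteqP; split=> [U Uq|U [V Vq /=]].
  by exists U; rewrite //= dist_refl Delta_gt0 // leq_maxl.
move=> UV; rewrite (leq_trans Vq) // leqNgt; apply/negP => VU.
move: UV; rewrite dist_Delta // ltNge Delta_le //.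
by rewrite geq_max leqnn (leq_trans _ VU).
Qed.

(** The distance from the larger of the two subspaces is [Delta] of its
    dimension; that from the smaller one is at most [Delta] of a smaller
    dimension. *)
Lemma max_dist_neq U V : \dim U != \dim V ->
  Num.max (dist U V) (dist V U) = Delta (maxn (\dim U) (\dim V)).
Proof.
case: ltngtP => // UV _.
  rewrite [dist V U]dist_Delta // max_r //.
  by rewrite (le_trans (dist_le_Delta _ _ _)) // Delta_le // ltnW.
rewrite [dist U V]dist_Delta // max_l //.
by rewrite (le_trans (dist_le_Delta _ _ _)) // Delta_le // ltnW.
Qed.

Lemma open_sym_dim q : open ([set U | \dim U = q] : set Gr_sym).
Proof.
rewrite (_ : mkset _ = \bigcup_(V in [set V | \dim V = q])
  [set U | Num.max (dist U V) (dist V U) < Delta 1]).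
  by apply: bigcup_open => V _; apply/open_sym_ball/Delta_gt0.
apply/seteqP; split=> [U Uq|U [V <- /=]].
  by exists U; rewrite //= dist_refl maxxx Delta_gt0.
have [//|UV] := eqVneq (\dim U) (\dim V).
by rewrite max_dist_neq // ltNge Delta_le // leq_max; move: UV; lia.
Qed.

(** The ball of radius [r] of [tau^+] around [W] is everything if [r] exceeds
    [Delta (\dim W)]; otherwise it involves only the subspaces of dimension at
    least [\dim W], and there [perp] is an isometry. *)
Lemma perp_continuous_minus_plus : continuous (perp : Gr_minus -> Gr_plus).
Proof.
apply: continuous_plus => W r r0; have [rW|Wr] := ltP (Delta (\dim W)) r.
  rewrite (_ : mkset _ = setT); first exact: openT.
  apply/seteqP; split=> // U _ /=.
  exact: le_lt_trans (dist_le_Delta _ _ _) rW.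
rewrite (_ : mkset _ =
  [set U | (\dim U <= n - \dim W)%N] `&` [set U | dist U (perp W) < r]).
  by apply: openI; [exact: open_minus_dim_le|exact: open_minus_ball].
apply/seteqP; split=> U /=.
  move=> Ur; suff UW : (\dim U <= n - \dim W)%N.
    by split; rewrite // -dist_perp ?perpK // dim_perp.
  rewrite leqNgt; apply/negP => UW; move: Ur; rewrite dist_Delta ?ltNge ?Wr //.
  by rewrite dim_perp; have := dim_le U; have := dim_le W; lia.
by move=> [UW]; rewrite -dist_perp ?perpK // dim_perp.
Qed.

(** For [U] such that [perp U] has dimension greater than [\dim W], the dimension
    of [U] decides whether [perp U] is in the ball of [tau^-] around [W]. If so,
    this ball contains the complements of all subspaces of dimension at least
    [\dim U], since [Delta] is monotone and bounds the distance. *)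
Lemma perp_continuous_plus_minus : continuous (perp : Gr_plus -> Gr_minus).
Proof.
apply: continuous_minus => W r r0.
rewrite (_ : mkset _ =
  ([set U | (n - \dim W <= \dim U)%N] `&` [set U | dist (perp W) U < r]) `|`
  \bigcup_(j in [set j | Delta (n - j) < r]) [set U | (j <= \dim U)%N]).
  apply: openU; last by apply: bigcup_open => j _; exact: open_plus_dim_ge.
  by apply: openI; [exact: open_plus_dim_ge|exact: open_plus_ball].
apply/seteqP; split=> U /=.
  have [UW|WU] := leqP (n - \dim W) (\dim U) => Ur.
    by left; split; rewrite // -dist_perp ?perpK // dim_perp.
  right; exists (\dim U) => //=; move: Ur; rewrite dist_Delta dim_perp //.
  by have := dim_le U; have := dim_le W; lia.
move=> [[WU]|[j /= jr jU]]; first by rewrite -dist_perp ?perpK // dim_perp.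
apply: le_lt_trans jr; apply: (le_trans (dist_le_Delta _ _ _)).
by rewrite dim_perp Delta_le // leq_sub2l.
Qed.

(** On the subspaces of the same dimension as [perp W], the map [perp] is an
    isometry for the symmetrized distance; for the other subspaces, the dimension
    decides whether they are mapped into the ball around [W]. *)
Lemma perp_continuous_sym : continuous (perp : Gr_sym -> Gr_sym).
Proof.
apply: continuous_sym => W r r0.
rewrite (_ : mkset _ =
  ([set U | \dim U = (n - \dim W)%N]
     `&` [set U | Num.max (dist U (perp W)) (dist (perp W) U) < r]) `|`
  \bigcup_(j in [set j | j != (n - \dim W)%N
                         /\ Delta (maxn (n - j) (\dim W)) < r])
    [set U | \dim U = j]).
  apply: openU; last by apply: bigcup_open => j _; exact: open_sym_dim.
  by apply: openI; [exact: open_sym_dim|exact: open_sym_ball].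
have neqW U : \dim U != (n - \dim W)%N -> \dim (perp U) != \dim W.
  by rewrite dim_perp; have := dim_le U; have := dim_le W; lia.
have eqW U : \dim U = (n - \dim W)%N ->
    Num.max (dist (perp U) W) (dist W (perp U))
    = Num.max (dist U (perp W)) (dist (perp W) U).
  by move=> UW; rewrite maxC -[in LHS](perpK W) !dist_perp ?dim_perp ?UW.
apply/seteqP; split=> U /=.
  have [UW|UW] := eqVneq (\dim U) (n - \dim W)%N; first by rewrite eqW //; left.
  by rewrite max_dist_neq ?neqW // dim_perp => Ur; right; exists (\dim U).
move=> [[UW]|[j [jW jr] Uj]]; first by rewrite eqW.
by rewrite max_dist_neq; [rewrite dim_perp Uj|apply: neqW; rewrite Uj].
Qed.

End BallTopologies.

(** * The usual topology *)

Section UsualTopology.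
Variables (R : realType) (k : scalars).
Local Notation F := (scal R k).
Local Notation conj := (@scal_conj R k).

Lemma continuous_scal_conj : continuous (conj : F -> F).
Proof.
move=> x; apply/(@cvgrPdist_lt F F F (nbhs x)) => e e0.
have : id y @[y --> x] --> x by exact: cvg_id.
move=> /(@cvgrPdist_lt F F F (nbhs x))/(_ e e0).
by apply: filterS => y; rewrite -rmorphB norm_scal_conj.
Qed.

Lemma open_neq0 : open ([set x | x != 0] : set F).
Proof.
rewrite (_ : mkset _ = ~` [set 0]); last first.
  by apply/seteqP; split=> x /= /eqP.
by apply: closed_openC;
  apply/accessible_closed_set1/hausdorff_accessible/(@norm_hausdorff F F).
Qed.

Lemma continuous_mx (X : topologicalType) (p q : nat) (A : X -> 'M[F]_(p, q)) :
  (forall i j, continuous (fun x => A x i j)) -> continuous A.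
Proof.
move=> Ac x B [P PA PB].
have : \forall y \near x, forall i j, P i j (A y i j).
  apply: filter_forall => i; apply: filter_forall => j;
    exact: (Ac i j x _ (PA i j)).
by apply: filterS => y /PB.
Qed.

Lemma continuous_entry (p q : nat) i j :
  continuous (fun A : 'M[F]_(p, q) => A i j).
Proof.
move=> A B AB; exists (fun i' j' => if (i' == i) && (j' == j) then B else setT).
  by move=> i' j'; case: ifP => [/andP[/eqP -> /eqP ->] //|_]; exact: filterT.
by move=> A' /(_ i j); rewrite !eqxx.
Qed.

Lemma continuous_scale (X : topologicalType) (a : F) (f : X -> F) :
  continuous f -> continuous (fun x => a * f x).
Proof.
move=> fc x; apply: (@continuousM F X (cst a) f x); first exact: cst_continuous.
exact: fc.
Qed.

Lemma continuous_det (X : topologicalType) (p : nat) (A : X -> 'M[F]_p) :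
  (forall i j, continuous (fun x => A x i j)) ->
  continuous (fun x => \det (A x)).
Proof.
move=> Ac; rewrite /determinant; apply: continuous_big => [|s _].
  exact: add_continuous.
apply: continuous_scale.
apply: continuous_big => [|i _]; first exact: mul_continuous.
exact: Ac.
Qed.

Lemma continuous_adjugate (X : topologicalType) (p : nat) (A : X -> 'M[F]_p) :
  (forall i j, continuous (fun x => A x i j)) ->
  forall i j, continuous (fun x => (\adj (A x)) i j).
Proof.
move=> Ac i j; under eq_fun do rewrite mxE /cofactor.
apply: continuous_scale.
by apply: continuous_det => i' j'; under eq_fun do rewrite !mxE; exact: Ac.
Qed.

(** The added rows are the last rows of the invertible matrix [row_ebase C]. *)
Lemma complete_row_free (K : fieldType) (p m : nat) (C : 'M[K]_(p, p + m)) :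
  row_free C -> exists D : 'M[K]_(m, p + m), col_mx C D \in unitmx.
Proof.
move=> /eqP Cfree; exists (dsubmx (row_ebase C)).
have CE := mulmx_ebase C; rewrite Cfree in CE.
have -> : col_mx C (dsubmx (row_ebase C))
        = block_mx (col_ebase C) 0 0 1%:M *m row_ebase C.
  rewrite -[X in _ *m X]vsubmxK mul_block_col !mul0mx mul1mx addr0 add0r.
  congr col_mx; rewrite -[LHS]CE pid_mx_row -mulmxA.
  by rewrite -[X in row_mx _ _ *m X]vsubmxK mul_row_col mul1mx mul0mx addr0.
by rewrite unitmx_mul row_ebase_unit unitmxE det_ublock det1 mulr1 -unitmxE
  col_ebase_unit.
Qed.

Section Perp.
Variables (p m : nat) (N : 'M[F]_(p + m, m)).
Implicit Type A : 'M[F]_(p, p + m).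

Definition completion A : 'M[F]_(p + m) := row_mx (map_mx conj A)^T N.

(** The adjugate of [M := completion A] satisfies [\adj M *m M = (\det M)%:M].
    The first [p] columns of [M] are the conjugates of the rows of [A], so the
    last [m] rows of the adjugate are orthogonal to the rows of [A]. Unlike the
    inverse matrix, the adjugate is polynomial, hence continuous everywhere. *)
Definition perp_frame A : 'M[F]_(m, p + m) := dsubmx (\adj (completion A)).

Lemma perp_frame_mul A :
  perp_frame A *m (map_mx conj A)^T = 0
  /\ perp_frame A *m N = (\det (completion A))%:M.
Proof.
have := mul_adj_mx (completion A).
rewrite /perp_frame; set M := \adj _; rewrite -{1}[M]vsubmxK.
rewrite mul_col_row scalar_mx_block => /eq_block_mx[_ _ ->].
by move=> ->.
Qed.

Lemma perp_frame_free A : \det (completion A) != 0 -> row_free (perp_frame A).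
Proof.
move=> D0; have [_ BN] := perp_frame_mul A; apply/row_freeP.
exists ((\det (completion A))^-1 *: N).
by rewrite -scalemxAr BN scale_scalar_mx mulVf.
Qed.

Lemma row_vspace_perp_frame A : row_free A -> \det (completion A) != 0 ->
  row_vspace (perp_frame A) = perp (row_vspace A).
Proof.
move=> Afree D0; apply/eqP; rewrite eqEdim dim_perp.
have /eqP -> := dim_row_vspace Afree.
have /eqP -> := dim_row_vspace (perp_frame_free D0).
rewrite addKn leqnn andbT -orthogonalE; apply/orthogonalP.
move=> _ _ /tnthP[i ->] /tnthP[j ->]; rewrite !tnth_mktuple.
have [/matrixP/(_ i j) + _] := perp_frame_mul A; rewrite !mxE => <-.
by apply: eq_bigr => l _; rewrite !mxE.
Qed.

Lemma continuous_completion i j : continuous (fun A => completion A i j).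
Proof.
rewrite /completion; case: (split_ordP j) => l ->.
  under eq_fun do rewrite row_mxEl !mxE.
  move=> A; apply: (@continuous_comp _ _ _ (fun A => A l i) conj).
    exact: continuous_entry.
  exact: continuous_scal_conj.
by under eq_fun do rewrite row_mxEr; move=> A; exact: cst_continuous.
Qed.

Lemma continuous_perp_frame : continuous perp_frame.
Proof.
apply: continuous_mx => i j; under eq_fun do rewrite mxE.
by apply: continuous_adjugate; exact: continuous_completion.
Qed.

End Perp.

(** Near a given frame [A], the map that takes complements of spans lifts to the
    continuous map [perp_frame N] on frames, where [N] is chosen so that
    [completion N A] is invertible. *)
Lemma usual_continuous (n p m : nat) (f : Gr_dim R k n p -> Gr_dim R k n m) :
  n = (p + m)%N -> (forall V, \val (f V) = perp (\val V)) -> continuous f.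
Proof.
move=> nE; subst n => fE; apply/continuousP => U; rewrite /open /=;
  case=> O oO OE.
rewrite /open /= /usual_open openE => A fA.
have Afree : row_free (set_val A) := set_valP A.
have [|D AD] := @complete_row_free _ _ _ (map_mx conj (set_val A)).
  by rewrite row_free_map.
pose N := D^T; pose B := perp_frame N.
have BE (C : @frames R k (p + m) p)
    (D0 : \det (completion N (set_val C)) != 0) :
    U (f (frame_span C)) <-> O (B (set_val C)).
  pose C' : @frames R k (p + m) m :=
    exist _ (B (set_val C)) (mem_set (perp_frame_free D0)).
  have -> : f (frame_span C) = frame_span C'.
    apply: val_inj; rewrite fE /=; apply/esym/row_vspace_perp_frame => //.
    exact: set_valP C.
  by move/seteqP: OE => [OU UO]; split; [exact: UO C'|exact: OU C'].
have A0 : \det (completion N (set_val A)) != 0.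
  by rewrite -unitfE -unitmxE /completion -unitmx_tr tr_row_mx !trmxK.
exists (set_val @^-1` ([set C | \det (completion N C) != 0] `&` B @^-1` O)).
split.
- eexists; last by [].
  apply: openI; last by apply: open_comp => // C _;
    exact: continuous_perp_frame.
  apply: (@open_comp _ _ _ [set x | x != 0]).
    by move=> C _; apply: continuous_det; exact: continuous_completion.
  exact: open_neq0.
- by split=> //; apply/BE.
- by move=> C [C0 /= OC]; apply/BE.
Qed.

End UsualTopology.

(** * Orthogonal complementation is a homeomorphism *)

Lemma homeomorphic_onto_restrict (X Y : topologicalType) (f : X -> Y)
    (g : Y -> X) (A : set X) (B : set Y) :
  continuous f -> continuous g -> cancel f g -> cancel g f ->
  (forall x, A x -> B (f x)) -> (forall y, B y -> A (g y)) ->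
  homeomorphic_onto f A B.
Proof.
move=> cf cg fg gf AB BA.
pose f' (x : A) : B := exist _ (f (set_val x)) (mem_set (AB _ (set_valP x))).
pose g' (y : B) : A := exist _ (g (set_val y)) (mem_set (BA _ (set_valP y))).
exists f'; split=> //; split.
  apply: continuous_comp_initial => x.
  by apply: (@continuous_comp _ _ _ set_val f);
    [exact: initial_continuous|exact: cf].
exists g'; split.
- by move=> x; apply: val_inj => /=; exact: fg.
- by move=> y; apply: val_inj => /=; exact: gf.
apply: continuous_comp_initial => y.
by apply: (@continuous_comp _ _ _ set_val g);
  [exact: initial_continuous|exact: cg].
Qed.

Theorem corollary4p5 (R : realType) (k : scalars) (n : nat) (d : metric) :
  [/\ @homeomorphism (Gr_minus R k n d) (Gr_plus R k n d) (@perp R k n),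
      @homeomorphism (Gr_sym R k n d) (Gr_sym R k n d) (@perp R k n)
    & forall p : nat, (p <= n)%N ->
        [/\ exists f : Gr_dim R k n p -> Gr_dim R k n (n - p),
              (forall V, \val (f V) = perp (\val V)) /\ homeomorphism f,
            @homeomorphic_onto (Gr_minus R k n d) (Gr_plus R k n d)
              (@perp R k n) [set V | \dim V = p] [set V | \dim V = (n - p)%N]
          & @homeomorphic_onto (Gr_sym R k n d) (Gr_sym R k n d)
              (@perp R k n) [set V | \dim V = p] [set V | \dim V = (n - p)%N]]].
Proof.
have c_minus := @perp_continuous_minus_plus R k n d.
have c_plus := @perp_continuous_plus_minus R k n d.
have c_sym := @perp_continuous_sym R k n d.
have K := @perpK R k n.
split.
- split; first exact: c_minus.
  by exists (@perp R k n); split; [exact: K|exact: K|exact: c_plus].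
- split; first exact: c_sym.
  by exists (@perp R k n); split; [exact: K|exact: K|exact: c_sym].
move=> p pn; have AB (V : Gr R k n) : \dim V = p -> \dim (perp V) = (n - p)%N.
  by move=> <-; exact: dim_perp.
have BA (V : Gr R k n) : \dim V = (n - p)%N -> \dim (perp V) = p.
  by move=> Vd; rewrite dim_perp Vd subKn.
split.
- have perp_dim (V : Gr_dim R k n p) : \dim (perp (\val V)) == (n - p)%N.
    by apply/eqP/AB/eqP; exact: valP V.
  have perp_dim' (V : Gr_dim R k n (n - p)) : \dim (perp (\val V)) == p.
    by apply/eqP/BA/eqP; exact: valP V.
  pose f V : Gr_dim R k n (n - p) := exist _ (perp (\val V)) (perp_dim V).
  pose g V : Gr_dim R k n p := exist _ (perp (\val V)) (perp_dim' V).
  exists f; split; first by [].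
  split; first by apply: usual_continuous; [rewrite subnKC|].
  exists g; split; last by apply: usual_continuous; [rewrite subnK|].
  + by move=> V; apply: val_inj; exact: K.
  + by move=> V; apply: val_inj; exact: K.
- exact: (homeomorphic_onto_restrict c_minus c_plus K K AB BA).
- exact: (homeomorphic_onto_restrict c_sym c_sym K K AB BA).
Qed.
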